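(* Let $d$ be a nonnegative integer and let $$H_1(x)=\sum_{i=1}^k \alpha_i (x+x_i)^d,$$ where $x_1,\ldots,x_k$ are distinct real constants, the $\alpha_i$ are nonzero real constants, and $k \leq (d+2)/4$. If $H_1$ is written in the form $$H_1(x)=\sum_{i=1}^l \beta_i (x+y_i)^{e_i}$$ with real constants $\beta_i,y_i$ and nonnegative integers $e_i \leq d$ for every $i$, then $l \geq k$. *)

(* Defs.v *)
From mathcomp Require Export all_boot all_order all_algebra.
From mathcomp Require Export reals.

Set Implicit Arguments.
Unset Strict Implicit.
Unset Printing Implicit Defensive.

(* Main.v *)
Require Import Defs.
From mathcomp Require Import all_boot all_order all_algebra.
From mathcomp Require Import reals polyrcf.
From mathcomp Require Import zify lra.

Import Order.TTheory GRing.Theory Num.Theory.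
Local Open Scope ring_scope.

(** If [\sum_i c_i (X - a_i)^(e_i) = 0], then the sum of truncated powers
    [S(t) = \sum_(a_i < t) c_i (t - a_i)^(e_i)] has compact support.  By Rolle,
    each differentiation of [S] creates one more sign change, except that every
    jump of the [j]-th derivative, i.e. every term with [e_i = j], may destroy
    two of them.  As the derivative of order [d + 1] vanishes, where [d] bounds
    the [e_i], a relation with an uncancelled term of exponent [d] has at least
    [(d + 2) / 2] terms.  If [l < k], some node [x_i] differs from all the
    [y_i], so that moving everything to one side yields such a relation with
    [k + l <= 2k - 1] terms, contradicting [4k <= d + 2]. *)

Section TruncatedPowers.

Set Implicit Arguments.
Unset Strict Implicit.

(** * Sums of truncated powers as piecewise polynomials *)

Variables (R : rcfType) (I : finType) (c a : I -> R) (e : I -> nat).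

(** The polynomial that agrees with [S] at [t] and just to its left. Working with it makes every
    derivative a formal one. *)
Definition left_part (t : R) : {poly R} :=
  \sum_(i | a i < t) c i *: ('X - (a i)%:P) ^+ e i.

(* The [j]-th derivative of [S], left-continuous at the knots [a i]. *)
Definition spline (j : nat) (t : R) : R := (left_part t)^`(j).[t].

Lemma derivn_XsubC_exp (b : R) (n j : nat) :
  (('X - b%:P) ^+ n)^`(j) = ('X - b%:P) ^+ (n - j) *+ n ^_ j.
Proof.
elim: j => [|j IHj]; first by rewrite derivn0 subn0 ffactn0 mulr1n.
rewrite derivnS IHj derivMn deriv_exp derivXsubC mul1r -mulrnA subnS.
by rewrite ffactnSr mulnC.
Qed.

Lemma left_part_split (u v : R) : u <= v ->
  left_part v =
    left_part u + \sum_(i | u <= a i < v) c i *: ('X - (a i)%:P) ^+ e i.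
Proof.
move=> uv; rewrite /left_part (bigID (fun i => a i < u)) /=; congr (_ + _).
  by apply: eq_bigl => i; case: (ltP (a i) u) => [/lt_le_trans->|] //=;
     rewrite andbF.
by apply: eq_bigl => i; rewrite -leNgt andbC.
Qed.

Lemma left_part_const (u t v : R) :
  u < t <= v -> (forall i, ~~ (u < a i < v)) -> left_part t = left_part v.
Proof.
case/andP=> ut tv noa; rewrite (left_part_split tv) big1 ?addr0 // => i.
by case/andP=> ta av; have := noa i; rewrite av (lt_le_trans ut ta).
Qed.

(** The polynomial valid just to the right of [u] differs from the one at [u] by the terms with knot
    [u]. The [j]-th derivative of such a term vanishes at [u] unless its exponent is [j], so without
    a jump the [j]-th derivative of [S] is continuous there. *)
Lemma spline_left_eval (j : nat) (u v : R) :
  u < v -> (forall i, ~~ (u < a i < v)) ->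
  (forall i, e i = j -> ~~ (u <= a i < v)) ->
  (left_part v)^`(j).[u] = spline j u.
Proof.
move=> uv noa nojump; rewrite (left_part_split (ltW uv)) derivnD hornerD.
rewrite [X in _ + X](_ : _ = 0) ?addr0 //.
rewrite (linear_sum (derivn j)) horner_sum big1 // => i /andP[ua av].
have aE : a i = u.
  by apply/le_anti; rewrite ua andbT leNgt; have := noa i; rewrite av andbT.
rewrite /= derivnZ hornerZ derivn_XsubC_exp hornerMn horner_exp !hornerE aE subrr.
rewrite expr0n subn_eq0; case: (ltngtP (e i) j) => [lt_ej|//|eq_ej].
- by rewrite ffact_small // mulr0n mulr0.
- by rewrite mul0rn mulr0.
by have := nojump i eq_ej; rewrite ua av.
Qed.

(** Induction on the number of knots inside: at a knot the increment splits into two, and one of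
    them has the sign of [s]. Without knots this is the mean value theorem for a polynomial. *)
Lemma spline_mean_value (j : nat) (s u v : R) :
  u < v -> (forall i, e i = j -> ~~ (u <= a i < v)) ->
  0 < s * (spline j v - spline j u) ->
  exists2 t, u < t < v & 0 < s * spline j.+1 t.
Proof.
have [n] := ubnP #|[pred i | u < a i < v]|.
elim: n => // n IHn in u v *; rewrite ltnS => le_n uv nojump incr.
have [i /andP[ua av]|noa] := pickP [pred i | u < a i < v]; last first.
  have {}noa i : ~~ (u < a i < v) by rewrite [X in ~~ X]noa.
  have [t] := mvt (left_part v)^`(j) uv.
  rewrite in_itv /= (spline_left_eval uv) // => /andP[ut tv] mvt_t.
  exists t; rewrite ?ut //; move: incr.
  rewrite {1}/spline mvt_t mulrA pmulr_lgt0 ?subr_gt0 //.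
  by rewrite /spline (@left_part_const u t v) // ut ltW.
have card_lt (B : pred I) : {subset B <= [pred i | u < a i < v]} -> ~~ B i ->
    (#|B| < n)%N.
  move=> sBA Bi; apply: leq_trans le_n; apply/proper_card/properP; split.
    exact/subsetP.
  by exists i => //; rewrite inE ua.
have [left_incr|left_decr] := ltP 0 (s * (spline j (a i) - spline j u)).
  have [||||t /andP[ut ta] t_gt0] := IHn u (a i) => //.
  - apply: card_lt => [i' /= | /=]; last by rewrite ltxx andbF.
    by rewrite !inE => /andP[-> /lt_trans->].
  - by move=> i' /nojump; apply: contra => /andP[-> /lt_trans->].
  by exists t; rewrite ?ut ?(lt_trans ta).
have [||||t /andP[at_ tv] t_gt0] := IHn (a i) v => //.
- apply: card_lt => [i' /= | /=]; last by rewrite ltxx.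
  by rewrite !inE => /andP[/(lt_trans ua)-> ->].
- by move=> i' /nojump; apply: contra => /andP[/(le_trans (ltW ua))-> ->].
- by move: incr left_decr; rewrite !mulrBr; lra.
by exists t; rewrite ?tv ?(lt_trans ua).
Qed.

(** * Counting sign alternations in the manner of Rolle *)

Fixpoint alternates (g : R -> R) (s lo : R) (ts : seq R) : bool :=
  if ts is t :: ts' then
    [&& lo < t, 0 < s * g t & alternates g (- s) t ts']
  else true.

Fixpoint zigzags (g : R -> R) (s u : R) (vs : seq R) : bool :=
  if vs is v :: vs' then
    [&& u < v, 0 < s * (g v - g u) & zigzags g (- s) v vs']
  else true.

Lemma alternates_weaken (g : R -> R) (s u v : R) (ts : seq R) :
  u <= v -> alternates g s v ts -> alternates g s u ts.
Proof. by case: ts => //= t ts uv /and3P[/(le_lt_trans uv)-> -> ->]. Qed.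

(** The zeros at both ends provide the gain in Rolle's theorem: [n] alternating values give [n + 1]
    alternating increments, the last one being the return to zero. *)
Lemma alternates_zigzags (g : R -> R) (s lo hi : R) (ts : seq R) :
  (forall t, hi <= t -> g t = 0) -> g lo = 0 -> ts != [::] ->
  alternates g s lo ts -> zigzags g s lo (rcons ts hi).
Proof.
move=> g_hi g_lo; case: ts => //= t ts _ /and3P[-> t_gt0 alt_ts].
rewrite g_lo subr0 t_gt0 /=.
elim: ts => [|t' ts IHts] /= in s t t_gt0 alt_ts *.
  rewrite g_hi // sub0r mulrNN t_gt0 !andbT ltNge; apply/negP => /g_hi gt0.
  by move: t_gt0; rewrite gt0 mulr0 ltxx.
case/and3P: alt_ts => -> t'_gt0 alt_ts; rewrite IHts // andbT.
by rewrite mulrBr !mulNr opprK -mulNr addr_gt0.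
Qed.

(* An interval of the zigzag that contains a jump yields nothing; dropping it
   together with its successor keeps the signs alternating. *)
Lemma zigzags_spline_deriv (j : nat) (s u : R) (vs : seq R) :
  zigzags (spline j) s u vs ->
  exists2 ts, alternates (spline j.+1) s u ts
    & (size vs <= size ts + 2 * #|[pred i | (e i == j) && (u <= a i)%R]|)%N.
Proof.
have [n] := ubnP (size vs); elim: n => // n IHn in s u vs *.
case: vs => [|v vs] /=; first by exists [::].
rewrite !ltnS => le_n /and3P[uv incr zig].
have [i /and3P[/eqP ei ua av]|nojump] :=
    pickP [pred i | [&& e i == j, u <= a i & a i < v]]; last first.
  have [|t /andP[ut tv] t_gt0] := @spline_mean_value j s u v uv _ incr.
    by move=> i /eqP ei; have := nojump i; rewrite /= ei /= => ->.
  have [ts alt_ts le_ts] := IHn (- s) v vs le_n zig.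
  exists (t :: ts); first by rewrite /= ut t_gt0 (alternates_weaken (ltW tv)).
  rewrite /= addSn ltnS (leq_trans le_ts) // leq_add2l leq_mul2l /=.
  apply/subset_leq_card/subsetP => i; rewrite !inE => /andP[-> /=].
  by apply: le_trans; rewrite ltW.
(* The knot [a i] lies below the start [w] of what remains, so its jump is charged only once and
   pays for the dropped intervals. *)
have card_gt0 (w : R) : a i < w -> u <= w ->
    (#|[pred i | (e i == j) && (w <= a i)%R]|
      < #|[pred i | (e i == j) && (u <= a i)%R]|)%N.
  move=> aw uw; apply/proper_card/properP; split.
    by apply/subsetP => i'; rewrite !inE => /andP[-> /(le_trans uw)].
  by exists i; rewrite !inE ei eqxx //= -ltNge.
case: vs => [|w vs] /= in le_n zig *.
  by exists [::] => //=; have := card_gt0 v av (ltW uv); lia.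
case/and3P: zig => vw _; rewrite opprK => zig.
have [ts alt_ts le_ts] := IHn s w vs (ltnW le_n) zig.
have uw := ltW (lt_trans uv vw).
exists ts; first exact: alternates_weaken alt_ts.
by have := card_gt0 w (lt_trans av vw) uw; lia.
Qed.

(** * Nonvanishing of the derivatives of [S] up to order [d] *)

Lemma left_part0 (t : R) : (forall i, t <= a i) -> left_part t = 0.
Proof. by move=> lo; rewrite /left_part big_pred0 // => i; rewrite ltNge lo. Qed.

Lemma derivn_neq0 (p : {poly R}) (j n : nat) :
  (j <= n)%N -> p`_n != 0 -> p^`(j) != 0.
Proof.
move=> le_jn; apply: contraNneq => /(congr1 (fun q : {poly R} => q`_(n - j))).
rewrite coef_derivn subnKC // coef0 => /eqP.
by rewrite mulrn_eq0 eqn0Ngt ffact_gt0 le_jn.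
Qed.

Lemma exists_nonroot (p : {poly R}) (w t : R) :
  p != 0 -> w < t -> exists2 r, w < r <= t & p.[r] != 0.
Proof.
(* These points are distinct and lie in the interval; [size p] of them are too many to be roots of
   [p]. *)
move=> p_neq0 wt; pose pt i := w + (t - w) / i.+1%:R.
have wt_gt0 : 0 < t - w by rewrite subr_gt0.
have pt_inj : injective pt.
  move=> m n /addrI /(mulfI (lt0r_neq0 wt_gt0)) /invr_inj /eqP.
  by rewrite eqr_nat => /eqP[].
have [/hasP[r /mapP[i _ ->] nroot]|/hasPn all_roots] :=
    boolP (has (fun r => p.[r] != 0) (map pt (iota 0 (size p)))).
  exists (pt i) => //; rewrite /pt ltrDl divr_gt0 ?ltr0n //=.
  by rewrite -lerBrDl ler_piMr ?(ltW wt_gt0) // invf_le1 ?ler1n ?ltr0n.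
have pt_roots : all (root p) (map pt (iota 0 (size p))).
  by apply/allP => r /all_roots; rewrite negbK.
have := max_poly_roots p_neq0 pt_roots.
by rewrite size_map size_iota ltnn map_inj_uniq ?iota_uniq // => /(_ isT).
Qed.

Lemma gap_below (s : seq R) (t : R) :
  exists2 w, w < t & {in s, forall r, r < t -> r <= w}.
Proof.
elim: s => [|r s [w wt w_ub]]; first by exists (t - 1); rewrite ?ltrBlDr ?ltrDl.
have [rt|tr] := ltP r t.
  exists (Num.max w r); first by rewrite gt_max wt.
  by move=> r'; rewrite inE le_max => /orP[/eqP->|/w_ub le_w /le_w ->];
     rewrite ?lexx ?orbT.
by exists w => // r'; rewrite inE => /orP[/eqP->|/w_ub//]; rewrite ltNge tr.
Qed.

Lemma gap_above (s : seq R) (t : R) :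
  exists2 w, t < w & {in s, forall r, t < r -> w <= r}.
Proof.
have [w wt w_lb] := gap_below (map -%R s) (- t).
exists (- w); first by rewrite ltrNr.
by move=> r rs tr; rewrite lerNl w_lb ?map_f // ltrN2.
Qed.

Lemma spline_neq0_at (j : nat) (t : R) :
  (left_part t)^`(j) != 0 -> exists r, spline j r != 0.
Proof.
have [w wt w_ub] := gap_below (codom a) t.
move=> /exists_nonroot/(_ wt)[r /andP[wr rt] nroot]; exists r.
rewrite /spline (@left_part_const w r t) ?wr // => i.
by apply/negP=> /andP[wa /(w_ub _ (codom_f a i))]; rewrite leNgt wa.
Qed.

(** Crossing [a i0] changes the coefficient of degree [d] by [c i0], as no other term of exponent
    [d] has that knot. Hence it is nonzero on one of the two sides, and differentiating [j <= d]
    times does not kill it. *)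
Lemma spline_neq0 (d j : nat) (i0 : I) :
  (j <= d)%N -> (forall i, (e i <= d)%N) -> e i0 = d -> c i0 != 0 ->
  (forall i, e i = d -> a i = a i0 -> i = i0) ->
  exists r, spline j r != 0.
Proof.
move=> le_jd e_le ei0 ci0 i0_uniq.
have [w aw w_lb] := gap_above (codom a) (a i0).
have jump_d : (left_part w)`_d != (left_part (a i0))`_d.
  rewrite (left_part_split (ltW aw)) coefD -subr_eq0 addrC addKr.
  rewrite coef_sum (bigD1 i0) ?lexx //= big1 ?addr0 => [|i].
    rewrite coefZ -ei0 mulf_neq0 //.
    have /monicP := monic_exp (e i0) (monicXsubC (a i0)).
    by rewrite lead_coefE size_exp_XsubC => ->; rewrite oner_neq0.
  case/andP=> /andP[ai0 iw] neq_i0; rewrite coefZ nth_default ?mulr0 //.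
  rewrite size_exp_XsubC ltn_neqAle e_le andbT.
  apply: contra neq_i0 => /eqP eid; apply/eqP/i0_uniq => //.
  apply/le_anti; rewrite ai0 andbT leNgt; apply/negP.
  by move=> /(w_lb _ (codom_f a i)); rewrite leNgt iw.
have [P0|] := eqVneq (left_part w)`_d 0.
  apply: (@spline_neq0_at _ (a i0)); apply: derivn_neq0 le_jd _.
  by rewrite eq_sym -[X in X != _]P0.
by move/(derivn_neq0 le_jd)/spline_neq0_at.
Qed.

(** * The lower bound on the number of terms of a relation *)

Lemma card_power_relation_ge (d : nat) (i0 : I) :
  (forall i, (e i <= d)%N) -> e i0 = d -> c i0 != 0 ->
  (forall i, e i = d -> a i = a i0 -> i = i0) ->
  \sum_i c i *: ('X - (a i)%:P) ^+ e i = 0 -> (d + 2 <= 2 * #|I|)%N.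
Proof.
move=> e_le ei0 ci0 i0_uniq rel0.
pose M : R := \sum_i `|a i|.
have le_M i : `|a i| <= M by rewrite /M (bigD1 i) //= lerDl sumr_ge0.
have [lo lo_le] : exists lo, forall i, lo <= a i.
  by exists (- M) => i; have := le_M i; rewrite ler_norml => /andP[].
have [hi hi_gt] : exists hi, forall i, a i < hi.
  by exists (M + 1) => i; rewrite (le_lt_trans (ler_norm _)) // ltr_pwDr.
have spline_lo j : spline j lo = 0.
  by rewrite /spline left_part0 // linear0 horner0.
have spline_hi j t : hi <= t -> spline j t = 0.
  move=> hit; rewrite /spline /left_part (eq_bigl predT) => [|i].
    by rewrite rel0 linear0 horner0.
  by rewrite (lt_le_trans (hi_gt i)).
(* The number of terms whose jump occurs in a derivative of order less than [j]; each accounts for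
   at most two lost alternations. *)
pose below j := #|[pred i | e i < j]%N|.
have belowS j : (below j + #|[pred i | (e i == j) && (lo <= a i)%R]|
    = below j.+1)%N.
  rewrite /below -cardUI [X in (_ + X)%N]eq_card0 ?addn0 => [|i].
    by apply: eq_card => i; rewrite !inE lo_le andbT orbC -leq_eqVlt.
  by rewrite !inE; case: ltngtP.
have below_le j : (below j <= #|I|)%N by exact: max_card.
clearbody below.
have step j s (ts : seq R) : ts != [::] -> alternates (spline j) s lo ts ->
    exists2 ts', alternates (spline j.+1) s lo ts'
      & (size ts + 1 + 2 * below j <= size ts' + 2 * below j.+1)%N.
  move=> ts_neq0 alt_ts.
  have zig := alternates_zigzags (@spline_hi j) (spline_lo j) ts_neq0 alt_ts.
  have [ts' alt_ts' le_ts'] := zigzags_spline_deriv zig.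
  exists ts' => //; rewrite -belowS mulnDr addnCA [X in (_ <= X)%N]addnC leq_add2r addn1.
  by rewrite -(size_rcons ts hi).
(* When all alternations are lost, a nonzero value of the derivative still supplies one, and this
   value itself can serve as the sign [s]. *)
have restart j : (j <= d)%N -> exists s r, alternates (spline j) s lo [:: r].
  move=> le_jd; have [r r_neq0] := spline_neq0 le_jd e_le ei0 ci0 i0_uniq.
  exists (spline j r), r; rewrite /= andbT -expr2 lt0r sqrf_eq0 r_neq0 sqr_ge0.
  rewrite /= andbT ltNge; apply: contraNN r_neq0 => r_lo.
  rewrite /spline left_part0 ?linear0 ?horner0 // => i.
  exact: le_trans (lo_le i).
(* Each derivative raises [size ts + 2 * below j] by at least one. If [step] returns an empty list,
   the jumps alone meet the bound, so restarting with one point keeps it and gives the nonempty list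
   that the next [step] requires. *)
have alt j : (j <= d)%N -> exists (s : R) (ts : seq R), [/\ ts != [::],
    alternates (spline j) s lo ts & (j + 1 <= size ts + 2 * below j)%N].
  elim: j => [|j IHj] le_jd.
    by have [s [r alt_r]] := restart 0%N le_jd; exists s, [:: r].
  have [s [ts [ts_neq0 alt_ts le_ts]]] := IHj (ltnW le_jd).
  have [ts' alt_ts' le_ts'] := step _ _ _ ts_neq0 alt_ts.
  case: ts' => [|t' ts'] in alt_ts' le_ts' *; last first.
    by exists s, (t' :: ts'); split=> //; lia.
  have [s' [r alt_r]] := restart _ le_jd; exists s', [:: r]; split=> //=.
  by move: le_ts'; rewrite /=; lia.
have [s [ts [ts_neq0 alt_ts le_ts]]] := alt d (leqnn d).
have [ts' alt_ts' le_ts'] := step _ _ _ ts_neq0 alt_ts.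
(* No alternation survives at order [d + 1], so the jumps alone account for [d + 2]. *)
have spline_d t : spline d.+1 t = 0.
  rewrite /spline derivn_poly0 ?horner0 //; apply: (leq_trans (size_sum _ _ _)).
  apply/bigmax_leqP => i _; apply: (leq_trans (size_scale_leq _ _)).
  by rewrite size_exp_XsubC ltnS.
case: ts' => [|t' ts'] in alt_ts' le_ts'; last first.
  by move: alt_ts'; rewrite /= spline_d mulr0 ltxx andbF.
by have := below_le d.+1; move: le_ts'; rewrite /=; lia.
Qed.

End TruncatedPowers.

(** * Application to two representations of the same polynomial *)

Theorem theorem14 (R : realType) (d k : nat) (alpha x : 'I_k -> R)
    (x_inj : injective x) (alpha_neq0 : forall i : 'I_k, alpha i != 0)
    (k_le : k%:R <= (d%:R + 2%:R) / 4%:R :> R)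
    (l : nat) (beta y : 'I_l -> R) (e : 'I_l -> nat)
    (e_le : forall i : 'I_l, (e i <= d)%N)
    (H1E : \sum_(i < k) alpha i *: ('X + (x i)%:P) ^+ d
           = \sum_(i < l) beta i *: ('X + (y i)%:P) ^+ e i :> {poly R}) :
  (k <= l)%N.
Proof.
rewrite leqNgt; apply/negP => lt_lk.
have /existsP[i0 /forallP i0_free] : [exists i0, forall i, y i != x i0].
  (* Otherwise, choosing for each [x i] an equal [y i'] would inject ['I_k] into ['I_l]. *)
  apply: contraLR lt_lk => /existsPn all_hit; rewrite -leqNgt.
  have [f fE] : exists f : 'I_k -> 'I_l, forall i, y (f i) = x i.
    apply: (@fin_all_exists _ _ (fun i i' => y i' = x i)) => i.
    by have /forallPn[i' /negPn/eqP] := all_hit i; exists i'.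
  rewrite -[k]card_ord -[l]card_ord; apply: (@leq_card _ _ f) => i i' eq_f.
  by apply: x_inj; rewrite -!fE eq_f.
(* The nodes are negated because the relation is stated with ['X - a], and [beta] because its terms
   move to the other side. *)
pose c (i : 'I_k + 'I_l) := match i with inl i => alpha i | inr i => - beta i end.
pose a (i : 'I_k + 'I_l) := match i with inl i => - x i | inr i => - y i end.
pose n (i : 'I_k + 'I_l) := match i with inl _ => d | inr i => e i end.
have := @card_power_relation_ge R _ c a n d (inl i0).
rewrite card_sum !card_ord => size_le.
suff : (d + 2 <= 2 * (k + l))%N.
  have : (4 * k <= d + 2)%N.
    by move: k_le; rewrite ler_pdivlMr ?ltr0n // -natrM -natrD ler_nat mulnC.
  lia.
apply: size_le => //.
- by case.
- exact: alpha_neq0.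
- by case=> [i _ /oppr_inj/x_inj->//|i _ /oppr_inj eq_yx]; have := i0_free i;
  rewrite eq_yx eqxx.
rewrite big_sumType /=; apply/eqP; rewrite addr_eq0 -sumrN; apply/eqP.
under eq_bigr do rewrite polyCN opprK.
by rewrite H1E; apply: eq_bigr => i _; rewrite polyCN opprK scaleNr opprK.
Qed.
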